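(* Let $D\ge2$ be squarefree and $K=\mathbb{Q}(\sqrt D)$. The uniquely decomposable elements $x\in\mathcal{O}_K^+$ are exactly the following: (a) $\alpha_{i,r}$ with odd $i\ge-1$ and $0\le r\le u_{i+2}-1$; (b) $e\alpha_{i,0}$ with odd $i\ge-1$ and $2\le e\le u_{i+1}+1$; (c) $\alpha_{i,u_{i+2}-1}+f\alpha_{i+2,0}$ with odd $i\ge-1$ such that $u_{i+2}\ge2$, and $1\le f\le u_{i+3}$; (d) $e\alpha_{i,0}+\alpha_{i,1}$ with odd $i\ge-1$ such that $u_{i+2}\ge2$, and $1\le e\le u_{i+1}$; (e) $e\alpha_{i,0}+f\alpha_{i+2,0}$ with odd $i\ge-1$ such that $u_{i+2}=1$, and $1\le e\le u_{i+1}+1$, $1\le f\le u_{i+3}+1$, $(e,f)\ne(u_{i+1}+1,u_{i+3}+1)$; (f) Galois conjugates of all elements in (a)–(e).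
   Context: $D\ge2$ is squarefree, $K=\mathbb{Q}(\sqrt D)$, $\mathcal{O}_K$ its ring of integers, $x'$ the Galois conjugate. Let $\omega_D=\sqrt D$ if $D\equiv 2,3\pmod 4$ and $\omega_D=\frac{1+\sqrt D}{2}$ if $D\equiv1\pmod4$. $\mathcal{O}_K^+$ is the set of $\alpha\in\mathcal{O}_K$ with $\alpha>0,\alpha'>0$; $\alpha\in\mathcal{O}_K^+$ is indecomposable if it is not a sum of two elements of $\mathcal{O}_K^+$, and uniquely decomposable if there is exactly one way (up to order of summands) to write it as a sum of indecomposable elements. Let $\sigma_D=\omega_D+\lfloor-\omega_D'\rfloor=[\overline{u_0,\dots,u_{s-1}}]$ (purely periodic continued fraction, positive integers $u_i$), extended by $u_{i+s}=u_i$. Define $p_{-1}=1,q_{-1}=0,p_0=\lceil u_0/2\rceil,q_0=1$, $X_{i+2}=u_{i+2}X_{i+1}+X_i$ ($i\ge-1$, $X\in\{p,q\}$), $\alpha_i=p_i-q_i\omega_D'$, $\alpha_{i,r}=\alpha_i+r\alpha_{i+1}$. *)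

(* Defs.v *)
From HB Require Import structures.
From mathcomp Require Import all_boot all_order all_algebra.
From mathcomp Require Import boolp classical_sets functions reals topology normedtype sequences.

Set Implicit Arguments.
Unset Strict Implicit.
Unset Printing Implicit Defensive.

Import Order.TTheory GRing.Theory Num.Theory.
Import numFieldNormedType.Exports.
Local Open Scope classical_set_scope.
Local Open Scope ring_scope.

Definition squarefree (n : nat) : Prop :=
  forall d : nat, (d ^ 2 %| n)%N -> d = 1%N.

(* K = Q(sqrt D) is the subfield of the reals R formed by the numbers
   a + b sqrt D with a, b rational. *)
Definition quadratic_field (R : realType) (D : nat) : set R :=
  [set x | exists a b : rat, x = ratr a + ratr b * Num.sqrt D%:R].

(* When D is not a square, a + b sqrt D determines a and b, so the set below is
   a singleton for x in K; outside K the value of conj is irrelevant. *)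
Definition conj (R : realType) (D : nat) (x : R) : R :=
  get [set y : R | exists a b : rat,
    x = ratr a + ratr b * Num.sqrt D%:R /\
    y = ratr a - ratr b * Num.sqrt D%:R].

Definition ring_of_integers (R : realType) (D : nat) : set R :=
  [set x | quadratic_field D x /\ integralOver (intr : int -> R) x].

Definition totally_positive_integers (R : realType) (D : nat) : set R :=
  [set x | [/\ ring_of_integers D x, 0 < x & 0 < conj D x]].

Definition indecomposable (R : realType) (D : nat) (x : R) : Prop :=
  totally_positive_integers D x /\
  ~ exists y z : R, [/\ totally_positive_integers D y,
                        totally_positive_integers D z & x = y + z].

(* A decomposition is the list of its summands; a single summand is allowed,
   so indecomposable elements are themselves uniquely decomposable. *)
Definition indecomposable_decomposition (R : realType) (D : nat) (x : R)
    (t : seq R) : Prop :=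
  (forall y : R, y \in t -> indecomposable D y) /\ x = \sum_(y <- t) y.

Definition uniquely_decomposable (R : realType) (D : nat) (x : R) : Prop :=
  totally_positive_integers D x /\
  exists t : seq R, indecomposable_decomposition D x t /\
    forall t' : seq R, indecomposable_decomposition D x t' -> perm_eq t' t.

Definition omega (R : realType) (D : nat) : R :=
  if (D %% 4 == 1)%N then (1 + Num.sqrt D%:R) / 2 else Num.sqrt D%:R.

Definition sigma (R : realType) (D : nat) : R :=
  omega R D + (Num.floor (- conj D (omega R D)))%:~R.

(* The finite continued fraction [u_0, ..., u_n]. *)
Fixpoint cfrac (R : realType) (u : nat -> nat) (n : nat) : R :=
  if n is m.+1 then (u 0%N)%:R + (cfrac R (fun k => u k.+1) m)^-1
  else (u 0%N)%:R.

Definition is_cfrac (R : realType) (u : nat -> nat) (x : R) : Prop :=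
  cfrac R u n @[n --> \oo] --> x.

Definition is_periodic_cfrac (R : realType) (s : nat) (u : nat -> nat)
    (x : R) : Prop :=
  [/\ (0 < s)%N, forall i, (0 < u i)%N, forall i, u (i + s)%N = u i
    & is_cfrac u x].

(* The sequences p_i, q_i, alpha_i start at i = -1, so they are indexed here
   by n = i + 1: [cf_p u n] is p_(n-1), and likewise for the others.  Hence
   odd i >= -1 corresponds to even n, and u_(i+1) to u n.
   [cf_rec u x0 x1 n] is X_(n-1), where X_(-1) = x0 and X_0 = x1;
   [uphalf k] is the ceiling of k / 2. *)
Fixpoint cf_rec (u : nat -> nat) (x0 x1 n : nat) : nat :=
  match n with
  | 0 => x0
  | 1 => x1
  | (k.+1 as m).+1 => (u m * cf_rec u x0 x1 m + cf_rec u x0 x1 k)%N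
  end.

Definition cf_p (u : nat -> nat) : nat -> nat := cf_rec u 1 (uphalf (u 0%N)).
Definition cf_q (u : nat -> nat) : nat -> nat := cf_rec u 0 1.

Definition alpha (R : realType) (D : nat) (u : nat -> nat) (n : nat) : R :=
  (cf_p u n)%:R - (cf_q u n)%:R * conj D (omega R D).

(* alpha_(n-1, r) *)
Definition alphar (R : realType) (D : nat) (u : nat -> nat) (n r : nat) : R :=
  alpha R D u n + r%:R * alpha R D u n.+1.

(* Main.v *)
Require Import Defs.
From mathcomp Require Import all_boot all_order all_algebra.
From mathcomp Require Import boolp classical_sets reals topology normedtype sequences.
From mathcomp Require Import zify ring lra.
Set Implicit Arguments.
Unset Strict Implicit.
Unset Printing Implicit Defensive.
Import Order.TTheory GRing.Theory Num.Theory.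
Import numFieldNormedType.Exports.
Local Open Scope ring_scope.

(** Enumerate the alpha_(i,r) with odd i and 0 <= r < u_(i+2) as b_0 = 1, b_1, ...
    and put b_(-j) = b_j'.  Then b_(j-1) + b_(j+1) = v_j b_j for all integers j,
    where v_j = u_(i+1) + 2 at b_j = alpha_(i,0) and v_j = 2 elsewhere, and every
    totally positive integer is a combination e b_j + f b_(j+1) with e, f >= 0.
    A linear form in (x, x') takes along the chain b values that satisfy the same
    recurrence and hence are convex as long as they are nonnegative (v_j >= 2).
    Applied to the coordinates in the basis (b_j, b_(j+1)) and to their sum, this
    shows that the indecomposables are exactly the b_j, and that e b_j + f b_(j+1)
    is uniquely decomposable iff e < v_j, f < v_(j+1) and not both e = v_j - 1 and
    f = v_(j+1) - 1; otherwise the recurrence gives a second decomposition. *)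

(** * Integrality of rationals, convex recurrences and bounds on sums *)

Lemma monic_dvd_int_poly (m : {poly rat}) (p : {poly int}) :
  m \is monic -> p \is monic -> m %| map_poly intr p ->
  exists m1 : {poly int}, m = map_poly intr m1.
Proof.
move=> mon_m mon_p /dvdpP_rat_int [p1 [c c0 mE] [r pE]].
(* The integer leading coefficients of [p1] and [r] have product 1, so that of [p1] is a sign; as
   [m] is monic, [c] is the same sign. *)
have lead1 : lead_coef p1 * lead_coef r = 1.
  by rewrite -lead_coefM -pE; apply/eqP.
have sq1 : lead_coef p1 * lead_coef p1 = 1.
  have := congr1 absz lead1; rewrite abszM => /eqP; rewrite muln_eq1 => /andP [/eqP + _]; nia.
have cE : c * (lead_coef p1)%:~R = 1.
  move/eqP: mon_m; rewrite mE lead_coefZ lead_coef_map_eq //=.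
  by rewrite intr_eq0; apply/eqP => p10; rewrite p10 mul0r in lead1.
exists (lead_coef p1 *: p1); rewrite mE map_polyZ /=; congr (_ *: _).
have /(congr1 (intr : int -> rat)) := sq1; rewrite rmorphM /= => sq1'.
have -> : c = c * ((lead_coef p1)%:~R * (lead_coef p1)%:~R) by rewrite sq1' mulr1.
by rewrite mulrA cE mul1r.
Qed.

(** With [q] in lowest terms, the square of its denominator is coprime to that of its numerator and
    hence divides [D]. *)
Lemma squarefree_mul_sqr_int (D : nat) (q : rat) :
  squarefree D -> D%:R * q ^+ 2 \is a Num.int -> q \is a Num.int.
Proof.
move=> sfD /intrP [z qz].
suff d1 : denq q = 1 by rewrite -[q]divq_num_den d1 divr1 intr_int.
have eqz : (D%:Z * numq q ^+ 2 = z * denq q ^+ 2)%R.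
  move: qz; rewrite -{1}[q]divq_num_den => qz.
  apply: (@intr_inj rat); rewrite !intrM /= -qz -[D%:~R]/(D%:R); field.
  by rewrite intr_eq0 denq_neq0.
have dvd : (`|denq q|%N ^ 2 %| D)%N.
  rewrite -(@Gauss_dvdl _ D (`|numq q|%N ^ 2)).
    apply/dvdnP; exists `|z|%N; move/(congr1 absz): eqz.
    by rewrite !abszM -!mulnn.
  by rewrite coprime_sym coprimeXl // coprimeXr // coprime_num_den.
have := sfD _ dvd; have := denq_gt0 q; lia.
Qed.

Lemma natr_abszE (R : numDomainType) (m : int) :
  0 <= m -> (`|m|%N)%:R = m%:~R :> R.
Proof. by move=> m0; rewrite natr_absz ger0_norm. Qed.

(** As [v n.+1] is at least 2 and [c n.+1] is nonnegative, each increment is at least the preceding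
    one. *)
Lemma convex_rec_mono (R : realDomainType) (c : nat -> R) (v : nat -> nat) :
  (forall n, (2 <= v n)%N) ->
  (forall n, c n + c n.+2 = (v n.+1)%:R * c n.+1) ->
  0 <= c 0%N -> c 0%N <= c 1%N -> forall n, 0 <= c n <= c n.+1.
Proof.
move=> v2 c_rec c0 c01; elim=> [|n /andP [IH0 IH]]; first by rewrite c0.
have cn0 := le_trans IH0 IH; rewrite cn0 /=.
have -> : c n.+2 = (v n.+1)%:R * c n.+1 - c n by rewrite -c_rec addrC addKr.
have : 2 * c n.+1 <= (v n.+1)%:R * c n.+1.
  by rewrite ler_wpM2r // ler_nat.
lra.
Qed.

Lemma sum_nseq (R : nzRingType) (x : R) n : \sum_(y <- nseq n x) y = n%:R * x.
Proof. by rewrite big_nseq iter_addr_0 mulr_natl. Qed.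

Lemma le_sum_mem (R : numDomainType) (T : eqType) (F : T -> R) (t : seq T) (y : T) :
  (forall z, z \in t -> 0 <= F z) -> y \in t -> F y <= \sum_(z <- t) F z.
Proof.
move=> F0 yt; rewrite (big_rem y yt) /= lerDl big_seq; apply: sumr_ge0 => z.
by move/mem_rem/F0.
Qed.

Lemma le_sum_mem2 (R : numDomainType) (T : eqType) (F : T -> R) (t : seq T) (y z : T) :
  (forall z, z \in t -> 0 <= F z) -> y \in t -> z \in t -> y != z ->
  F y + F z <= \sum_(z <- t) F z.
Proof.
move=> F0 yt zt yz; rewrite (big_rem y yt) /= lerD2l; apply: le_sum_mem.
  by move=> x /mem_rem/F0.
by rewrite rem_mem // eq_sym.
Qed.

(** * The enumeration of the alpha_(i,r) *)

Section AlphaSequence.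
Variable u : nat -> nat.
Hypothesis u_gt0 : forall i, (0 < u i)%N.

(* A pair (n, r) stands for alphar R D u n r, that is alpha_(n-1,r); the bound
   r < u n.+1 makes the enumeration pass from (n, u n.+1 - 1) to (n.+2, 0). *)
Definition next_index (nr : nat * nat) : nat * nat :=
  if (nr.2.+1 < u nr.1.+1)%N then (nr.1, nr.2.+1) else (nr.1.+2, 0%N).

Definition index_of (j : nat) : nat * nat := iter j next_index (0%N, 0%N).

Lemma index_ofS j : index_of j.+1 = next_index (index_of j).
Proof. by []. Qed.

Lemma index_ofP j : ~~ odd (index_of j).1 /\ ((index_of j).2 < u (index_of j).1.+1)%N.
Proof.
elim: j => [|j [IH1 IH2]]; first by split=> //=.
rewrite /index_of /= -/(index_of j) /next_index.
by case: ifP => /= [->|_]; split => //=; rewrite ?negbK.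
Qed.

(** Induction on [r] inside a strong induction on [n]: for positive [n], the pair [(n, 0)] succeeds
    the last pair of row [n - 2]. *)
Lemma index_of_surj n r : ~~ odd n -> (r < u n.+1)%N -> exists j, index_of j = (n, r).
Proof.
have [m] := ubnP n; elim: m n r => // m IH n; elim=> [|r IHr] nm n_even ru; last first.
  have [j jE] := IHr nm n_even (ltnW ru); exists j.+1.
  by rewrite /index_of /= -/(index_of j) jE /next_index /= ru.
case: n nm n_even ru => [|[|n]] // nm n_even ru; first by exists 0%N.
have un := u_gt0 n.+1.
have [|||j jE] := IH n (u n.+1).-1 _ _ _; [lia| |lia|].
  by rewrite /= negbK in n_even.
exists j.+1; by rewrite /index_of /= -/(index_of j) jE /next_index /= prednK // ltnn.
Qed.

Definition weight (j : nat) : nat :=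
  if (index_of j).2 == 0%N then (u (index_of j).1 + 2)%N else 2%N.

Lemma weight_ge2 j : (2 <= weight j)%N.
Proof. by rewrite /weight; case: ifP => // _; rewrite leq_addl. Qed.

Lemma weightS j : weight j.+1 =
  if ((index_of j).2.+1 < u (index_of j).1.+1)%N then 2%N
  else (u (index_of j).1.+2 + 2)%N.
Proof. by rewrite /weight index_ofS /next_index; case: ltnP => _ /=. Qed.

Variables (R : realType) (D : nat).
Local Notation w' := (conj D (omega R D)).

Lemma alpha0 : alpha R D u 0 = 1.
Proof. by rewrite /alpha /= mul0r subr0. Qed.

Lemma alpha1 : alpha R D u 1 = (uphalf (u 0%N))%:R - w'.
Proof. by rewrite /alpha /= mul1r. Qed.

Lemma alpha_rec n : alpha R D u n.+2 = (u n.+1)%:R * alpha R D u n.+1 + alpha R D u n.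
Proof.
rewrite /alpha /cf_p /cf_q -![cf_rec _ _ _ n.+2]/(_ + _)%N !natrD !natrM; ring.
Qed.

Lemma alphar_wrap n : alphar R D u n (u n.+1) = alphar R D u n.+2 0.
Proof. by rewrite /alphar mul0r addr0 alpha_rec addrC. Qed.

Definition alpha_seq (j : nat) : R := alphar R D u (index_of j).1 (index_of j).2.

(** No case distinction at the end of a row: by [alpha_rec], [alphar n r] with [r = u n.+1] is
    already the first element of row [n.+2]. *)
Lemma alpha_seqS j :
  alpha_seq j.+1 = alphar R D u (index_of j).1 (index_of j).2.+1.
Proof.
have [_ ru] := index_ofP j.
rewrite /alpha_seq /index_of /= -/(index_of j) /next_index; case: ifP => // /negbT.
rewrite -leqNgt => ur; have -> : (index_of j).2.+1 = u (index_of j).1.+1 by lia.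
by rewrite /alphar /= mul0r addr0 alpha_rec addrC.
Qed.

Lemma alpha_seqB j : alpha_seq j.+1 - alpha_seq j = alpha R D u (index_of j).1.+1.
Proof. by rewrite alpha_seqS /alpha_seq /alphar -natr1; ring. Qed.

(** The increments are constant inside a row, which gives weight 2. On entering row [n], the
    increment grows from [alpha n.-1] to [alpha n.+1], that is by [u n] times [alpha n]. *)
Lemma alpha_seq_rec j : alpha_seq j + alpha_seq j.+2 = (weight j.+1)%:R * alpha_seq j.+1.
Proof.
have -> : alpha_seq j.+2 = alpha_seq j.+1 + alpha R D u (index_of j.+1).1.+1.
  by rewrite -alpha_seqB; ring.
have -> : alpha_seq j = alpha_seq j.+1 - alpha R D u (index_of j).1.+1.
  by rewrite -alpha_seqB; ring.
rewrite /weight /alpha_seq /index_of /= -/(index_of j) /next_index.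
case: ifP => _ /=; first by ring.
by rewrite /alphar mul0r addr0 (alpha_rec (index_of j).1.+1) natrD; ring.
Qed.

Lemma alpha_seq0 : alpha_seq 0 = 1.
Proof. by rewrite /alpha_seq /alphar /= mul0r addr0 alpha0. Qed.

Lemma alpha_seq1 : alpha_seq 1 = (uphalf (u 0%N)).+1%:R - w'.
Proof. by rewrite alpha_seqS /alphar /= alpha0 alpha1 -natr1; ring. Qed.

(** Trades the position [j] for the pair [(n, r)], in which the families of the theorem are
    written. *)
Lemma alpha_seq_comboP (y : R) :
  (exists j e f : nat, [/\ (0 < e)%N, (e < weight j)%N, (f < weight j.+1)%N,
    ~ (e.+1 = weight j /\ f.+1 = weight j.+1) &
    y = e%:R * alpha_seq j + f%:R * alpha_seq j.+1]) <->
  exists n r e f : nat, ~~ odd n /\ (r < u n.+1)%N /\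
    let v0 := if r == 0%N then (u n + 2)%N else 2%N in
    let v1 := if (r.+1 < u n.+1)%N then 2%N else (u n.+2 + 2)%N in
    [/\ (0 < e)%N, (e < v0)%N, (f < v1)%N,
    ~ (e.+1 = v0 /\ f.+1 = v1) & y = e%:R * alphar R D u n r + f%:R * alphar R D u n r.+1].
Proof.
split=> [[j [e [f]]]|[n [r [e [f [n_even [ru]]]]]]].
  rewrite weightS alpha_seqS; have [n_even ru] := index_ofP j => h.
  by exists (index_of j).1, (index_of j).2, e, f.
have [j jE] := index_of_surj n_even ru => h.
by exists j, e, f; rewrite weightS alpha_seqS /alpha_seq /weight jE.
Qed.

End AlphaSequence.

(** * Continued fractions *)

Section CompleteQuotients.
Local Open Scope classical_set_scope.
Local Open Scope ring_scope.
Variable R : realType.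
Implicit Types (u : nat -> nat) (x : R).

Lemma cfrac_bounds u n : (forall i, (0 < u i)%N) ->
  (u 0%N)%:R <= cfrac R u n <= (u 0%N)%:R + 1.
Proof.
elim: n u => [|n IH] u u0 /=; first by rewrite lexx ler_wpDr.
have /andP [h _] := IH (fun k => u k.+1) (fun k => u0 k.+1).
have c1 : 1 <= cfrac R (fun k => u k.+1) n by apply: le_trans h; rewrite ler1n.
rewrite lerDl lerD2l invr_ge0 invf_le1 ?c1 ?andbT ?(le_trans ler01) //.
exact: lt_le_trans c1.
Qed.

Lemma is_cfracS u x : is_cfrac u x -> (fun n => cfrac R u n.+1) @ \oo --> x.
Proof. by rewrite /is_cfrac -cvg_shiftS. Qed.

(** The inequality stays strict in the limit because the tails are at most [u 1 + 1], so all later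
    convergents exceed [u 0] by at least [1 / (u 1 + 1)]. *)
Lemma is_cfrac_gt u x : (forall i, (0 < u i)%N) -> is_cfrac u x -> (u 0%N)%:R < x.
Proof.
move=> u0 /is_cfracS ux.
apply: (@lt_le_trans _ _ ((u 0%N)%:R + ((u 1%N)%:R + 1)^-1)).
  by rewrite ltrDl invr_gt0 ltr_wpDl.
apply: (cvgr_to_ge ux); apply: nearW => n /=.
have /andP [h1 h2] := cfrac_bounds n (fun k => u0 k.+1).
have c0 : 0 < cfrac R (fun k => u k.+1) n by apply: lt_le_trans h1; rewrite ltr0n.
by rewrite lerD2l lef_pV2 // posrE ltr_wpDl.
Qed.

Lemma is_cfrac_tail u x : (forall i, (0 < u i)%N) -> is_cfrac u x ->
  is_cfrac (fun k => u k.+1) (x - (u 0%N)%:R)^-1.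
Proof.
move=> u0 ux; have ux0 := is_cfrac_gt u0 ux.
rewrite /is_cfrac.
have -> : cfrac R (fun k => u k.+1) = (fun n => (cfrac R u n.+1 - (u 0%N)%:R)^-1).
  by apply/funext => n /=; rewrite addrC addKr invrK.
apply: cvgV; first by rewrite subr_eq0 gt_eqF.
by apply: cvgB; [exact: is_cfracS|exact: cvg_cst].
Qed.

(** The upper bound holds because the next complete quotient [1 / (x - u 0)] exceeds [u 1], hence
    1. *)
Lemma is_cfrac_floor u x : (forall i, (0 < u i)%N) -> is_cfrac u x ->
  (u 0%N)%:R < x < (u 0%N)%:R + 1.
Proof.
move=> u0 ux; have ux0 := is_cfrac_gt u0 ux; rewrite ux0 /=.
have /= := is_cfrac_gt (fun k => u0 k.+1) (is_cfrac_tail u0 ux) => h.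
have : 1 < (x - (u 0%N)%:R)^-1 by apply: le_lt_trans h; rewrite ler1n.
by rewrite invf_gt1 ?subr_gt0 // ltrBlDl.
Qed.

(* With complete quotients x = x_0, x_(n+1) = 1 / (x_n - u_n), the relation
   y_n = - x_n y_(n+1) propagates along the recurrence. *)
Lemma cf_alternate u x (y : nat -> R) : (forall i, (0 < u i)%N) -> is_cfrac u x ->
  (forall n, y n.+2 = (u n)%:R * y n.+1 + y n) ->
  0 < y 0%N -> y 0%N = - x * y 1%N -> forall n, 0 < (-1) ^+ n * y n.
Proof.
move=> u0 ux y_rec y0 y01 n; elim: n u x y u0 ux y_rec y0 y01 => [|n IH] u x y u0 ux y_rec y0 y01.
  by rewrite mul1r.
have ux0 := is_cfrac_gt u0 ux.
have x0 : 0 < x by apply: le_lt_trans ux0.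
rewrite exprS mulN1r mulNr -mulrN.
apply: (IH (fun k => u k.+1) (x - (u 0%N)%:R)^-1 (fun n => - y n.+1)) => //.
- exact: is_cfrac_tail.
- by move=> k; rewrite y_rec; ring.
- by rewrite -(pmulr_rgt0 _ x0) mulrN -mulNr -y01.
by rewrite y_rec y01; field; rewrite subr_eq0 gt_eqF.
Qed.

End CompleteQuotients.

(** * Integers of a real quadratic field *)

Section QuadraticField.
Variables (R : realType) (D : nat).
Hypotheses (D_ge2 : (2 <= D)%N) (sfD : squarefree D).
Local Notation rD := (Num.sqrt (D%:R : R)).

Lemma sqr_rD : rD ^+ 2 = D%:R.
Proof. by rewrite sqr_sqrtr. Qed.

Lemma rD_free (a b : rat) : ratr a + ratr b * rD = 0 -> a = 0 /\ b = 0.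
Proof.
case: (eqVneq b 0) => [->|b0].
  by rewrite raddf0 mul0r addr0 => /eqP; rewrite fmorph_eq0 => /eqP.
move=> ab0; exfalso; pose c := - a / b.
have cE : rD = ratr c.
  have rb0 : ratr b != 0 :> R by rewrite fmorph_eq0.
  by rewrite /c fmorph_div rmorphN /=; apply: (mulfI rb0); rewrite -(addr0_eq ab0); field.
have c2 : c ^+ 2 = D%:R.
  apply: (fmorph_inj (ratr : rat -> R)).
  by rewrite rmorphXn /= -cE sqr_rD ratr_nat.
have D0 : (D%:R : rat) != 0 by rewrite pnatr_eq0; lia.
have c0 : c != 0 by apply: contraNneq D0 => c0; rewrite -c2 c0 expr0n.
(* The inverse of [c] is the useful one: [D] times its square is 1, so it is an integer whose square
   divides 1 with cofactor [D]. *)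
have : c^-1 \is a Num.int.
  by apply: (@squarefree_mul_sqr_int D) => //; rewrite exprVn -c2 divff ?expf_neq0.
case/intrP => m mE; have : (m ^+ 2 * D%:Z = 1)%R.
  by apply: (@intr_inj rat); rewrite !intrM /= -mE -[D%:~R]/(D%:R) -expr2 -c2 -exprMn mulVf ?expr1n.
by move=> /(congr1 absz)/eqP; rewrite abszM muln_eq1 => /andP [_ /eqP D1]; move: D_ge2 D1; clear; lia.
Qed.

Lemma rD_inj (a b c d : rat) :
  ratr a + ratr b * rD = ratr c + ratr d * rD -> a = c /\ b = d.
Proof.
move=> e; have : ratr (a - c) + ratr (b - d) * rD = 0.
  by rewrite !rmorphB /=; apply/eqP; move/eqP: e; rewrite -subr_eq0; congr (_ == _); ring.
by move=> /rD_free [/eqP + /eqP]; rewrite !subr_eq0 => /eqP -> /eqP ->.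
Qed.

Lemma conjE (a b : rat) :
  conj D (ratr a + ratr b * rD) = ratr a - ratr b * rD.
Proof.
rewrite /conj; apply: get_unique; first by exists a, b.
by move=> y [c [d [/rD_inj [<- <-] ->]]].
Qed.

(* By Gauss's lemma the minimal polynomial over Q has integer coefficients. *)
Lemma integral_trace_norm (a b : rat) :
  integralOver (intr : int -> R) (ratr a + ratr b * rD) ->
  (2 * a \is a Num.int) /\ (a ^+ 2 - D%:R * b ^+ 2 \is a Num.int).
Proof.
move=> [p mon_p px].
have pE : map_poly (intr : int -> R) p = map_poly ratr (map_poly (intr : int -> rat) p).
  by rewrite -map_poly_comp; apply: eq_map_poly => z /=; rewrite ratr_int.
rewrite pE in px.
case: (eqVneq b 0) => [b0|b0].
  have : 'X - a%:P %| map_poly intr p.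
    rewrite dvdp_XsubCl; move: px.
    by rewrite b0 raddf0 mul0r addr0 fmorph_root.
  case/(monic_dvd_int_poly (monicXsubC a) mon_p) => m /polyP /(_ 0%N).
  rewrite coefB coefX coefC coef_map /= sub0r => aE.
  have a_int : a \is a Num.int by rewrite -[a]opprK aE rpredN intr_int.
  by rewrite b0 expr0n /= mulr0 subr0 rpredM ?rpredX ?rpred_nat.
set t := 2 * a; set N := _ - _.
pose m := Poly [:: N; - t; 1].
have mE : m = [:: N; - t; 1] :> seq _ by rewrite (@PolyK _ 0) //= oner_neq0.
have mon_m : m \is monic by rewrite monicE lead_coefE mE.
suff /(monic_dvd_int_poly mon_m mon_p) [m1 m1E] : m %| map_poly intr p.
  have m1i i : m`_i = (m1`_i)%:~R by rewrite m1E coef_map.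
  have := m1i 0%N; rewrite mE /= => ->.
  have := m1i 1%N; rewrite mE /= => /eqP; rewrite eqr_oppLR -rmorphN => /eqP ->.
  by rewrite !intr_int.
set P := map_poly intr p; set x := ratr a + _ in px.
have mx : (map_poly ratr m).[x] = 0.
  rewrite horner_coef size_map_poly mE /= !big_ord_recl big_ord0 /= !coef_map mE /=.
  rewrite /bump /= /x /t /N !(rmorphN, rmorphB, rmorphM, rmorph1, rmorphXn, ratr_nat) /=.
  have := sqr_rD; set s := rD => s2.
  by ring: s2.
(* The remainder modulo [m] has degree at most 1 and vanishes at [x]; as [b] is nonzero, [rD_free]
   forces it to be 0. *)
have rx : (map_poly ratr (P %% m)).[x] = 0.
  have PE : map_poly ratr P = map_poly ratr (P %/ m) * map_poly ratr m
      + map_poly ratr (P %% m) :> {poly R}.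
    by rewrite [in LHS](divp_eq P m) raddfD /= rmorphM.
  by move: px; rewrite -/P PE /root !hornerE mx mulr0 add0r => /eqP.
have szr : (size (P %% m)%R <= 2)%N.
  by rewrite -ltnS -[3%N]/(size [:: N; - t; 1]) -mE ltn_modp monic_neq0.
apply/modp_eq0P; move: rx szr; set r := P %% m => rx szr.
have := rx; rewrite (@horner_coef_wide _ 2) ?size_map_poly // !big_ord_recl big_ord0 /=.
rewrite !coef_map /= expr0 expr1 mulr1 addr0 /x => r0.
have /rD_free [r01 r1b] : ratr (r`_0 + r`_1 * a) + ratr (r`_1 * b) * rD = 0.
  by rewrite rmorphD !rmorphM /= -r0; ring.
have r1 : r`_1 = 0 by move/eqP: r1b; rewrite mulf_eq0 (negPf b0) orbF => /eqP.
rewrite r1 mul0r addr0 in r01.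
apply/polyP => -[|[|i]]; rewrite ?coef0 //.
by rewrite nth_default // (leq_trans szr).
Qed.

Lemma squarefree_mod4 : (D %% 4 != 0)%N.
Proof. by apply/negP => D4; have := @sfD 2%N D4. Qed.

(** The trace of omega, a boolean read as 0 or 1. *)
Definition omega_trace : nat := (D %% 4 == 1)%N.
Local Notation w := (omega R D).
Local Notation w' := (conj D (omega R D)).

Lemma omegaE :
  w = if (D %% 4 == 1)%N then ratr (1 / 2) + ratr (1 / 2) * rD
      else ratr 0 + ratr 1 * rD.
Proof.
rewrite /omega; case: ifP => _; last by rewrite rmorph0 rmorph1 add0r mul1r.
by rewrite fmorph_div rmorph1 /= ratr_nat; field.
Qed.

Lemma conj_omega : w' = omega_trace%:R - w.
Proof.
rewrite {1}omegaE /omega_trace /omega; case: ifP => _; rewrite conjE.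
  by rewrite fmorph_div rmorph1 /= ratr_nat; field.
by rewrite rmorph0 rmorph1 mul1r.
Qed.

Lemma conj_qint (a b : int) :
  conj D (a%:~R - b%:~R * w') = a%:~R - b%:~R * w.
Proof.
rewrite conj_omega /omega_trace omegaE; case: ifP => _.
  transitivity (conj D (ratr (a%:~R - b%:~R / 2) + ratr (b%:~R / 2) * rD)).
    congr (conj _ _); rewrite !rmorphB !fmorph_div /= !ratr_int ratr_nat.
    by field.
  by rewrite conjE !rmorphB !fmorph_div /= !ratr_int ratr_nat; field.
transitivity (conj D (ratr a%:~R + ratr b%:~R * rD)).
  by congr (conj _ _); rewrite rmorph0 rmorph1 !ratr_int; ring.
by rewrite conjE rmorph0 rmorph1 !ratr_int; ring.
Qed.

Lemma integral_quadratic (t n : int) (y : R) :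
  y ^+ 2 = t%:~R * y + n%:~R -> integralOver (intr : int -> R) y.
Proof.
move=> y2; pose m : {poly int} := Poly [:: - n; - t; 1].
have mE : m = [:: - n; - t; 1] :> seq _ by rewrite (@PolyK _ 0) //= oner_neq0.
exists m; first by rewrite monicE lead_coefE mE.
rewrite /root horner_coef size_map_poly_id0 ?lead_coefE mE /= ?oner_neq0 //.
rewrite !big_ord_recl big_ord0 /= !coef_map mE /=.
by rewrite !rmorphN /= rmorph1; apply/eqP; ring: y2.
Qed.

Lemma integral_omega : integralOver (intr : int -> R) w.
Proof.
(* If D = 1 mod 4, the square of omega is omega + (D - 1)/4, and (D - 1)/4 is [D %/ 4]; otherwise it
   is D. *)
apply: (@integral_quadratic omega_trace (if (D %% 4 == 1)%N then (D %/ 4)%N else D)).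
have := sqr_rD; rewrite /omega_trace /omega; case: ifP => D1 r2; last first.
  by rewrite r2 mul0r add0r.
have DE : (D%:R : R) = (D %/ 4)%:R * 4 + 1.
  by rewrite {1}(divn_eq D 4) (eqP D1) natrD natrM.
rewrite -!pmulrn; apply: (@mulfI _ 4); first by rewrite pnatr_eq0.
have -> : 4 * ((1 + rD) / 2) ^+ 2 = 1 + 2 * rD + rD ^+ 2 by field.
rewrite r2 [X in _ + X = _]DE mulr1n mul1r; set k := (_ %/ _)%:R; set s := Num.sqrt _.
by field.
Qed.

Lemma ring_of_integersP (x : R) :
  ring_of_integers D x <-> exists a b : int, x = a%:~R - b%:~R * w'.
Proof.
split; last first.
  case=> a [b ->]; split.
    rewrite conj_omega /omega_trace omegaE; case: ifP => _.
      exists (a%:~R - b%:~R / 2), (b%:~R / 2).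
      rewrite !rmorphB !fmorph_div /= !ratr_int ratr_nat.
      by field.
    by exists a%:~R, b%:~R; rewrite rmorph0 rmorph1 !ratr_int; ring.
  rewrite conj_omega; apply: integral_sub; first exact: integral_id.
  apply: integral_mul; first exact: integral_id.
  apply: integral_sub; last exact: integral_omega.
  exact: integral_nat.
case=> -[a [b ->]] /integral_trace_norm [/intrP [t tE] /intrP [N NE]].
(* With t = 2a and N the norm, D (2b)^2 = t^2 - 4N is an integer. *)
have /intrP [m mE] : 2 * b \is a Num.int.
  apply: (squarefree_mul_sqr_int sfD); apply/intrP; exists (t * t - 4 * N).
  by rewrite rmorphB /= !intrM /= -tE -NE; ring.
have aE : a = t%:~R / 2 by rewrite -tE; field.
have bE : b = m%:~R / 2 by rewrite -mE; field.
have e : t * t - D%:Z * (m * m) = 4 * N.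
  apply: (@intr_inj rat); rewrite rmorphB /= !intrM /= -NE aE bE -[D%:~R]/(D%:R).
  by field.
have D0 := squarefree_mod4.
(* Parities in t^2 - D m^2 = 4N: for D = 1 mod 4, [t] and [m] have the same parity; for D = 2, 3 mod
   4 both are even. *)
have [t0 [t1 [tE' t1E]]] : exists t0 t1 : int, t = 2 * t0 + t1 /\ (t1 = 0 \/ t1 = 1).
  by exists (t %/ 2)%Z, (t %% 2)%Z; lia.
have [m0 [m1 [mE' m1E]]] : exists t0 t1 : int, m = 2 * t0 + t1 /\ (t1 = 0 \/ t1 = 1).
  by exists (m %/ 2)%Z, (m %% 2)%Z; lia.
have De : D%:Z = 4 * (D %/ 4)%:Z + (D %% 4)%:Z by lia.
have r4 : (D %% 4 < 4)%N by rewrite ltn_pmod.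
rewrite De tE' mE' in e; move: e D0 r4.
rewrite conj_omega /omega_trace /omega aE bE tE' mE' !fmorph_div /= !ratr_int ratr_nat.
rewrite !rmorphD /= !intrM /=; clear -t1E m1E; move: (D %/ 4)%N (D %% 4)%N => k r e r0 r4.
case: ifP => r1 /=.
  have ? : t1 = m1 by move: r1 e => /eqP ->; case: t1E => ->; case: m1E => ->; lia.
  by exists (t0 + m0 + t1), (2 * m0 + m1); rewrite !rmorphD /= !intrM /=; subst t1; field.
have [-> ->] : t1 = 0 /\ m1 = 0.
  have : r = 2%N \/ r = 3%N by lia.
  by case=> rE; move: e; rewrite rE; case: t1E => ->; case: m1E => ->; lia.
by exists t0, m0; field.
Qed.

Local Notation O := (@ring_of_integers R D).
Local Notation TP := (@totally_positive_integers R D).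

(** * Conjugation on the ring of integers *)

Lemma ring_of_integers_lin (m n : int) (x y : R) :
  O x -> O y -> O (m%:~R * x + n%:~R * y) /\
    conj D (m%:~R * x + n%:~R * y) = m%:~R * conj D x + n%:~R * conj D y.
Proof.
move=> /ring_of_integersP [a [b ->]] /ring_of_integersP [c [d ->]].
have -> : m%:~R * (a%:~R - b%:~R * w') + n%:~R * (c%:~R - d%:~R * w') =
    (m * a + n * c)%:~R - (m * b + n * d)%:~R * w'.
  by rewrite !rmorphD /= !intrM; ring.
split; first by apply/ring_of_integersP; exists (m * a + n * c), (m * b + n * d).
by rewrite !conj_qint !rmorphD /= !intrM; ring.
Qed.

Lemma ring_of_integersD (x y : R) : O x -> O y -> O (x + y).
Proof. by move=> Ox Oy; have [+ _] := ring_of_integers_lin 1 1 Ox Oy; rewrite !mul1r. Qed.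

Lemma conjD (x y : R) : O x -> O y -> conj D (x + y) = conj D x + conj D y.
Proof. by move=> Ox Oy; have [_ +] := ring_of_integers_lin 1 1 Ox Oy; rewrite !mul1r. Qed.

Lemma ring_of_integers_int (a : int) : O a%:~R.
Proof. by apply/ring_of_integersP; exists a, 0; rewrite mul0r subr0. Qed.

Lemma conj_int (a : int) : conj D (a%:~R : R) = a%:~R.
Proof. by have := conj_qint a 0; rewrite !mul0r !subr0. Qed.

Lemma ring_of_integers_conj (x : R) : O x -> O (conj D x).
Proof.
move=> /ring_of_integersP [a [b ->]]; apply/ring_of_integersP.
exists (a - b * omega_trace), (- b).
by rewrite conj_qint conj_omega rmorphB rmorphN /= intrM -pmulrn; ring.
Qed.

Lemma conjK (x : R) : O x -> conj D (conj D x) = x.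
Proof.
move=> /ring_of_integersP [a [b ->]].
have -> : conj D (a%:~R - b%:~R * w') =
    (a - b * omega_trace)%:~R - (- b)%:~R * w'.
  by rewrite conj_qint conj_omega rmorphB rmorphN /= intrM -pmulrn; ring.
by rewrite conj_qint conj_omega rmorphB rmorphN /= intrM -pmulrn; ring.
Qed.

Lemma conj_sum (t : seq R) : (forall y, y \in t -> O y) ->
  O (\sum_(y <- t) y) /\ conj D (\sum_(y <- t) y) = \sum_(y <- t) conj D y.
Proof.
elim: t => [|z t IH] Ot; first by rewrite !big_nil; split;
  [exact: (ring_of_integers_int 0) | exact: (conj_int 0)].
have Oz : O z by apply: Ot; rewrite mem_head.
have [|Os conjs] := IH; first by move=> y yt; apply: Ot; rewrite in_cons yt orbT.
by rewrite !big_cons -conjs; split; [exact: ring_of_integersD|exact: conjD].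
Qed.

Lemma totally_positive_conj (x : R) : TP x -> TP (conj D x).
Proof.
by move=> [Ox x0 x'0]; split; rewrite ?conjK //; exact: ring_of_integers_conj.
Qed.

(** * Decompositions along a two-sided chain *)

Section Chain.
Variables (b : nat -> R) (v : nat -> nat).
(** These abstract the properties of [alpha_seq] and [weight]. By [b1O], 1 and [b 1] form a Z-basis
    of the ring of integers; [b_rec0] is the recurrence at 0, where the left neighbour of [b 0] is
    the conjugate of [b 1]. *)
Hypotheses (b0 : b 0%N = 1) (b1O : exists z : int, b 1%N = z%:~R - w').
Hypotheses (bO : forall j, O (b j)) (v_ge2 : forall j, (2 <= v j)%N).
Hypotheses (b_rec : forall j, b j + b j.+2 = (v j.+1)%:R * b j.+1)
  (b_rec0 : b 1%N + conj D (b 1%N) = (v 0%N)%:R).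
Hypotheses (cb_gt0 : forall j, 0 < conj D (b j))
  (cb_decr : forall j, conj D (b j.+1) < conj D (b j)).

Definition chain (k : int) : R :=
  match k with Posz n => b n | Negz n => conj D (b n.+1) end.
Local Notation g := chain.

Lemma conj_b0 : conj D (b 0%N) = 1.
Proof. by rewrite b0; exact: (conj_int 1). Qed.

Lemma chainO k : O (g k).
Proof. by case: k => n /=; first exact: bO; exact/ring_of_integers_conj/bO. Qed.

Lemma chain_opp k : g (- k) = conj D (g k).
Proof.
case: k => [[|n]|n]; first by rewrite oppr0 /= conj_b0.
  by [].
by rewrite NegzE opprK -NegzE /= conjK.
Qed.

Lemma conj_b_rec j : conj D (b j) + conj D (b j.+2) = (v j.+1)%:R * conj D (b j.+1).
Proof.
rewrite -conjD // b_rec; have [_] := ring_of_integers_lin (v j.+1) 0 (bO j.+1) (bO 0%N).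
by rewrite !mul0r !addr0.
Qed.

Lemma chain_rec k : g (k - 1) + g (k + 1) = (v `|k|%N)%:R * g k.
Proof.
case: k => [[|n]|[|n]].
- by rewrite /= b0 mulr1 -b_rec0 addrC.
- have -> : n.+1%:Z - 1 = n by lia.
  have -> : n.+1%:Z + 1 = n.+2 by lia.
  exact: b_rec.
- have -> : Negz 0 - 1 = Negz 1 by lia.
  have -> : Negz 0 + 1 = 0 by lia.
  have := conj_b_rec 0; rewrite /= conj_b0 => <-; by rewrite b0 addrC.
- have -> : Negz n.+1 - 1 = Negz n.+2 by lia.
  have -> : Negz n.+1 + 1 = Negz n by lia.
  by rewrite addrC; exact: conj_b_rec.
Qed.

(** The trace of [b 1] is at least 2, and its conjugate is below 1. *)
Lemma b1_gt1 : 1 < b 1%N.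
Proof.
have := cb_decr 0; rewrite conj_b0 => c1; have := v_ge2 0.
rewrite -(ler_nat R) -b_rec0; lra.
Qed.

Lemma b_mono j : 0 <= b j <= b j.+1.
Proof.
apply: (convex_rec_mono v_ge2 b_rec); rewrite b0 //.
exact/ltW/b1_gt1.
Qed.

Lemma b_gt0 j : 0 < b j.
Proof.
elim: j => [|j IH]; first by rewrite b0.
by apply: (lt_le_trans IH); case/andP: (b_mono j).
Qed.

Lemma chain_gt0 k : 0 < g k.
Proof. by case: k => n /=; [exact: b_gt0|exact: cb_gt0]. Qed.

Lemma chainTP k : TP (g k).
Proof.
split; [exact: chainO|exact: chain_gt0|].
by rewrite -chain_opp chain_gt0.
Qed.

(** * Coordinates with respect to two consecutive chain elements *)

Let delta := b 1%N - conj D (b 1%N).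

Lemma delta_gt0 : 0 < delta.
Proof. by have := b1_gt1; have := cb_decr 0; rewrite conj_b0 /delta; lra. Qed.

(** A discrete Wronskian: [g k] and [g (- k)] solve the same recurrence, whose step matrix has
    determinant 1. *)
Lemma chain_det k : g (- k) * g (k + 1) - g k * g (- (k + 1)) = delta.
Proof.
have step i : g (- (i + 1)) * g (i + 1 + 1) - g (i + 1) * g (- (i + 1 + 1)) =
    g (- i) * g (i + 1) - g i * g (- (i + 1)).
  have := chain_rec (i + 1); have := chain_rec (- (i + 1)).
  rewrite abszN; have -> : i + 1 - 1 = i by lia.
  have -> : - (i + 1) - 1 = - (i + 1 + 1) by lia.
  have -> : - (i + 1) + 1 = - i by lia.
  set V := (v _)%:R => e1 e2.
  have -> : g (i + 1 + 1) = V * g (i + 1) - g i by rewrite -e2; ring.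
  have -> : g (- (i + 1 + 1)) = V * g (- (i + 1)) - g (- i) by rewrite -e1; ring.
  ring.
have base : g (- 0) * g (0 + 1) - g 0 * g (- (0 + 1)) = delta.
  by rewrite /delta /= b0 !mul1r.
elim: k => [//|n IH|n IH].
  have -> : n.+1%:Z = n%:Z + 1 by lia.
  by rewrite step.
have := step (- n.+1%:Z); have -> : - n.+1%:Z + 1 = - n%:Z by lia.
by rewrite IH => ->.
Qed.

Lemma form_rec (A B : R) k :
  (A * g (k - 1) + B * g (- (k - 1))) + (A * g (k + 1) + B * g (- (k + 1)))
  = (v `|k|%N)%:R * (A * g k + B * g (- k)).
Proof.
have := chain_rec k; have := chain_rec (- k); rewrite abszN.
have -> : - k - 1 = - (k + 1) by lia.
have -> : - k + 1 = - (k - 1) by lia.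
by move=> e1 e2; rewrite mulrDr !(mulrCA _ A) !(mulrCA _ B) -e1 -e2; ring.
Qed.

(** [convex_rec_mono] started at [j]. Only this direction is treated, since the reflection of [k] to
    [- k] gives the other. *)
Lemma form_right (A B : R) (l := fun k => A * g k + B * g (- k)) j :
  0 <= l j <= l (j + 1) ->
  forall i i' : int, j <= i -> i <= i' -> 0 <= l i <= l i'.
Proof.
move=> l0 i i' ji ii'.
have mono n : 0 <= l (j + n%:Z) <= l (j + n.+1%:Z).
  apply: (@convex_rec_mono _ (fun n : nat => l (j + n%:Z)) (fun n : nat => v `|(j + n%:Z)%R|%N)).
  - by move=> m; exact: v_ge2.
  - move=> m /=; have := form_rec A B (j + m.+1%:Z).
    have -> : j + m.+1%:Z - 1 = j + m%:Z by lia.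
    by have -> : j + m.+1%:Z + 1 = j + m.+2%:Z by lia.
  - by case/andP: l0; rewrite addr0.
  - by case/andP: l0; rewrite addr0.
have -> : i = j + `|i - j|%N%:Z by lia.
have -> : i' = j + (`|i - j| + `|i' - i|)%N%:Z by lia.
elim: `|i' - i|%N => [|n /andP [IH0 IH]].
  by rewrite addn0 lexx andbT; case/andP: (mono `|i - j|%N).
by rewrite IH0 (le_trans IH) // addnS; case/andP: (mono (`|i - j| + n)%N).
Qed.

(* pairing j k = g_j' g_k - g_j g_k' is delta times the coordinate of g k along
   g (j + 1) in the basis (g j, g (j + 1)). *)
Definition pairing (j k : int) : R := g (- j) * g k - g j * g (- k).

Lemma pairingE (j k : int) : pairing j k = g (- j) * g k + (- g j) * g (- k).
Proof. by rewrite /pairing mulNr. Qed.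

Lemma pairing_rec (j k : int) :
  pairing j (k - 1) + pairing j (k + 1) = (v `|k|%N)%:R * pairing j k.
Proof. by rewrite !pairingE form_rec. Qed.

Lemma pairingxx j : pairing j j = 0.
Proof. by rewrite /pairing mulrC subrr. Qed.

Lemma pairing_next j : pairing j (j + 1) = delta.
Proof. exact: chain_det. Qed.

Lemma pairing_next2 j : pairing j (j + 2) = (v `|(j + 1)%R|%N)%:R * delta.
Proof.
have := pairing_rec j (j + 1); rewrite addrK pairingxx add0r pairing_next.
by have -> : j + 1 + 1 = j + 2 by lia.
Qed.

(** The values at [j], [j + 1], [j + 2] are 0, [delta] and the weight at [j + 1] times [delta];
    beyond that, convexity applies. *)
Lemma pairing_right (j k : int) : j <= k ->
  0 <= pairing j k /\ (j + 2 <= k -> (v `|(j + 1)%R|%N)%:R * delta <= pairing j k).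
Proof.
have base : 0 <= pairing j j <= pairing j (j + 1).
  by rewrite pairingxx pairing_next lexx ltW // delta_gt0.
rewrite pairingE [pairing j (j + 1)]pairingE in base.
move=> jk; rewrite pairingE; have mono := form_right base; split.
  by case/andP: (mono _ _ jk (lexx k)).
move=> jk2; rewrite -pairing_next2 pairingE.
by have /andP [] := mono (j + 2) k ltac:(lia) jk2.
Qed.

(* By the symmetry k |-> - k of the chain, the second summand is delta times the
   coordinate of g k along g j. *)
Definition height (j k : int) : R := pairing j k + pairing (- (j + 1)) (- k).

Lemma height_opp (j k : int) : height (- (j + 1)) (- k) = height j k.
Proof.
rewrite /height addrC opprK.
by have -> : - (- (j + 1) + 1) = j by lia.
Qed.

Lemma heightE (j k : int) :
  height j k = (g (- j) - g (- (j + 1))) * g k + (g (j + 1) - g j) * g (- k).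
Proof. by rewrite /height /pairing !opprK; ring. Qed.

(** The coordinate sum is 1 at [j] and [j + 1]; at [j + 2] it is the weight at [j + 1] minus 1,
    since [g (j + 2)] is that weight times [g (j + 1)] minus [g j]. *)
Lemma height_right (j k : int) : j <= k ->
  delta <= height j k /\
  (j + 2 <= k -> ((v `|(j + 1)%R|%N)%:R - 1) * delta <= height j k).
Proof.
have h0 : height j j = delta.
  rewrite /height pairingxx add0r -(pairing_next (- (j + 1))).
  by congr pairing; lia.
have h1 : height j (j + 1) = delta.
  by rewrite /height pairing_next pairingxx addr0.
have h2 : height j (j + 2) = ((v `|(j + 1)%R|%N)%:R - 1) * delta.
  have := form_rec (g (- j) - g (- (j + 1))) (g (j + 1) - g j) (j + 1).
  rewrite -!heightE addrK h0 h1; have -> : j + 1 + 1 = j + 2 by lia.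
  by move=> e; rewrite mulrBl mul1r -e; ring.
have base : 0 <= height j j <= height j (j + 1).
  by rewrite h0 h1 lexx ltW // delta_gt0.
rewrite heightE [height j (j + 1)]heightE in base.
have mono := form_right base => jk; split.
  by rewrite -h0 !heightE; case/andP: (mono j k (lexx j) jk).
move=> jk2; rewrite -h2 !heightE.
by have /andP [] := mono (j + 2) k ltac:(lia) jk2.
Qed.

Lemma height_left (j k : int) : k <= j + 1 ->
  delta <= height j k /\
  (k <= j - 1 -> ((v `|j|%N)%:R - 1) * delta <= height j k).
Proof.
move=> kj; have [|h1 h2] := @height_right (- (j + 1)) (- k); first by lia.
rewrite !height_opp in h1 h2; split => // kj2; move: h2.
have -> : - (j + 1) + 1 = - j by lia.
by rewrite abszN; apply; lia.
Qed.

Lemma height_ge (j k : int) : delta <= height j k.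
Proof.
by have [/height_right []|kj] := leP j k; [|apply: (height_left _).1; lia].
Qed.

Lemma pairing_left (j k : int) : k <= j + 1 ->
  0 <= pairing (- (j + 1)) (- k) /\
  (k <= j - 1 -> (v `|j|%N)%:R * delta <= pairing (- (j + 1)) (- k)).
Proof.
move=> kj; have [|h1 h2] := @pairing_right (- (j + 1)) (- k); first by lia.
split => // kj2; move: h2.
have -> : - (j + 1) + 1 = - j by lia.
by rewrite abszN; apply; lia.
Qed.

(** * Linear forms in an element and its conjugate *)

Definition lform (A B x : R) : R := A * x + B * conj D x.

Lemma lform_lin (A B x y : R) (m n : nat) : O x -> O y ->
  lform A B (m%:R * x + n%:R * y) = m%:R * lform A B x + n%:R * lform A B y.
Proof.
move=> Ox Oy; have [_ +] := ring_of_integers_lin m n Ox Oy.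
by rewrite /lform -!pmulrn => ->; ring.
Qed.

Lemma lform_sum (A B : R) (t : seq R) : (forall y, y \in t -> O y) ->
  lform A B (\sum_(y <- t) y) = \sum_(y <- t) lform A B y.
Proof.
by move=> Ot; rewrite /lform (conj_sum Ot).2 big_split /= -!mulr_sumr.
Qed.

(** [coord_l] and [coord_r] are [delta] times the coordinates along [g j] and [g (j + 1)]; [hform]
    is their sum. *)
Definition coord_l (j : int) := lform (- g (- (j + 1))) (g (j + 1)).
Definition coord_r (j : int) := lform (g (- j)) (- g j).
Definition hform (j : int) := lform (g (- j) - g (- (j + 1))) (g (j + 1) - g j).

Lemma coord_l_chain (j k : int) : coord_l j (g k) = pairing (- (j + 1)) (- k).
Proof. by rewrite /coord_l /lform -chain_opp /pairing !opprK; ring. Qed.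

Lemma coord_r_chain (j k : int) : coord_r j (g k) = pairing j k.
Proof. by rewrite /coord_r /lform -chain_opp /pairing; ring. Qed.

Lemma hform_chain (j k : int) : hform j (g k) = height j k.
Proof. by rewrite /hform /lform -chain_opp heightE. Qed.

Definition combo (j : int) (e f : nat) : R := e%:R * g j + f%:R * g (j + 1).

Lemma coord_l_combo (j : int) (e f : nat) : coord_l j (combo j e f) = e%:R * delta.
Proof.
rewrite /coord_l lform_lin -?/(coord_l _ _) ?coord_l_chain; try exact: chainO.
rewrite pairingxx mulr0 addr0; congr (_ * _).
have -> : - j = - (j + 1) + 1 by lia.
exact: pairing_next.
Qed.

Lemma coord_r_combo (j : int) (e f : nat) : coord_r j (combo j e f) = f%:R * delta.
Proof.
rewrite /coord_r lform_lin -?/(coord_r _ _) ?coord_r_chain; try exact: chainO.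
by rewrite pairingxx mulr0 add0r pairing_next.
Qed.

Lemma hform_combo (j : int) (e f : nat) : hform j (combo j e f) = (e + f)%:R * delta.
Proof.
rewrite natrD mulrDl -(coord_l_combo j e f) -(coord_r_combo j e f).
by rewrite /hform /coord_l /coord_r /lform; ring.
Qed.

(** * Spanning by consecutive chain elements, and the indecomposables *)

(* Passing from (b_j, b_(j+1)) to (b_(j+1), b_(j+2)) replaces (m, n) by
   (n + m v_(j+1), - m); when m < 0 the second coefficient drops because b' is
   decreasing. *)
Lemma descent (N j : nat) (m n : int) : 0 <= n -> n <= N%:Z ->
  0 < m%:~R * b j + n%:~R * b j.+1 ->
  0 < m%:~R * conj D (b j) + n%:~R * conj D (b j.+1) ->
  exists i e f : nat, (0 < e)%N /\
    m%:~R * b j + n%:~R * b j.+1 = e%:R * b i + f%:R * b i.+1.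
Proof.
elim: N j m n => [|N IH] j m n n0 nN x0 x'0.
  have nE : n = 0 by lia.
  move: x0; rewrite nE mul0r addr0 pmulr_lgt0 ?b_gt0 // ltr0z => m0.
  by exists j, `|m|%N, 0%N; split; [lia|rewrite natr_abszE ?mul0r ?addr0 // ltW].
have [m0|m0|m0] := ltgtP m 0.
- have mn : - m < n.
    have [//|nm] := ltP (- m) n; exfalso.
    have : n%:~R * conj D (b j.+1) <= (- m)%:~R * conj D (b j).
      apply: ler_pM; rewrite ?ler0z ?ler_int //; first exact/ltW/cb_gt0.
      exact/ltW/cb_decr.
    by rewrite rmorphN mulNr /=; lra.
  have xE (c : nat -> R) : c j + c j.+2 = (v j.+1)%:R * c j.+1 ->
      m%:~R * c j + n%:~R * c j.+1 =
      (n + m * (v j.+1)%:Z)%:~R * c j.+1 + (- m)%:~R * c j.+2.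
    move=> ce; rewrite rmorphD /= intrM -[(v j.+1)%:~R]/((v j.+1)%:R) mulrDl -mulrA -ce.
    by rewrite rmorphN /=; ring.
  rewrite (xE _ (b_rec j)) in x0 *.
  rewrite (xE (fun i => conj D (b i)) (conj_b_rec j)) in x'0.
  by apply: IH => //; lia.
- by exists j, `|m|%N, `|n|%N; split; [lia|rewrite !natr_abszE // ltW].
exists j.+1, `|n|%N, 0%N; rewrite m0 !mul0r add0r addr0.
rewrite natr_abszE //; split => //.
by move: x0; rewrite m0 mul0r add0r pmulr_lgt0 ?b_gt0 // ltr0z; lia.
Qed.

(** The difference of [x] and its conjugate is [delta] times the coefficient of [b 1] in the basis
    (1, [b 1]), so that coefficient is nonnegative and [descent] can start at index 0. *)
Lemma span_ge (x : R) : TP x -> conj D x <= x ->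
  exists j e f : nat, (0 < e)%N /\ x = combo j e f.
Proof.
move=> [/ring_of_integersP [p [q xE]] x0 x'0] x'x.
have [z b1E] := b1O.
have qE : x = (p - q * z)%:~R * b 0%N + q%:~R * b 1%N.
  by rewrite xE b0 b1E rmorphB /= intrM; ring.
have q'E : conj D x = (p - q * z)%:~R * conj D (b 0%N) + q%:~R * conj D (b 1%N).
  by rewrite qE; apply: (ring_of_integers_lin _ _ (bO 0%N) (bO 1%N)).2.
have q0 : 0 <= q.
  have : 0 <= q%:~R * delta.
    by move: x'x; rewrite q'E qE conj_b0 b0 /delta; lra.
  by rewrite (pmulr_lge0 _ delta_gt0) ler0z.
rewrite q'E in x'0; rewrite qE in x0 *.
have [|i [e [f [e0 ->]]]] := @descent `|q|%N 0 (p - q * z) q q0 _ x0 x'0; first lia.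
exists i, e, f; split => //; rewrite /combo.
by have -> : i%:Z + 1 = i.+1 by lia.
Qed.

Lemma chain_span (x : R) : TP x ->
  exists (k : int) (e f : nat), (0 < e + f)%N /\ x = combo k e f.
Proof.
move=> TPx; have [x'x|xx'] := leP (conj D x) x.
  by have [j [e [f [e0 ->]]]] := span_ge TPx x'x; exists j, e, f; split => //; lia.
have [|j [e [f [e0 xE]]]] := span_ge (totally_positive_conj TPx).
  by rewrite conjK ?ltW //; case: TPx.
exists (- (j%:Z + 1)), f, e; split; first lia.
rewrite -[LHS]conjK; last by case: TPx.
rewrite xE /combo; have [_ ->] := ring_of_integers_lin e f (chainO j) (chainO (j%:Z + 1)).
rewrite -!chain_opp; have -> : - (j%:Z + 1) + 1 = - j%:Z by lia.
by rewrite addrC.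
Qed.

Lemma hform_TP_ge (j : int) (x : R) : TP x -> delta <= hform j x.
Proof.
case/chain_span => k [e [f [ef0 ->]]].
rewrite /hform lform_lin -?/(hform _ _) ?hform_chain; try exact: chainO.
have he := height_ge j k; have hf := height_ge j (k + 1).
apply: (@le_trans _ _ ((e + f)%:R * delta)).
  by rewrite ler_peMl ?ler1n // ltW // delta_gt0.
by rewrite natrD mulrDl lerD // ler_wpM2l.
Qed.

(** [hform k] is [delta] at [g k], but at least twice [delta] on a sum of two totally positive
    integers. *)
Lemma indecomposable_chain (k : int) : indecomposable D (g k).
Proof.
split; first exact: chainTP.
case=> y [z [TPy TPz gE]].
have := hform_TP_ge k TPy; have := hform_TP_ge k TPz.
have : hform k (g k) = hform k y + hform k z.
  have [[Oy _ _] [Oz _ _]] := (TPy, TPz).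
  by rewrite gE /hform /lform conjD //; ring.
have := hform_combo k 1 0; rewrite /combo mul1r mul0r addr0 => ->.
by have := delta_gt0; lra.
Qed.

Lemma combo_TP (j : int) (e f : nat) : (0 < e + f)%N -> TP (combo j e f).
Proof.
move=> ef0; have [Ox cx] := ring_of_integers_lin e f (chainO j) (chainO (j + 1)).
have pos (x y : R) : 0 < x -> 0 < y -> 0 < e%:R * x + f%:R * y.
  move=> x0 y0; case: e ef0 {Ox cx} => [|e _].
    by rewrite mul0r add0r => f0; rewrite mulr_gt0 ?ltr0n.
  by rewrite ltr_pwDl ?mulr_gt0 ?ltr0n // mulr_ge0 // ltW.
split=> //; first by apply: pos; exact: chain_gt0.
by rewrite cx -!chain_opp; apply: pos; exact: chain_gt0.
Qed.

(** A combination with [e + f] at least 2 splits off one chain element and leaves a totally positive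
    rest. *)
Lemma indecomposableP (y : R) : indecomposable D y -> exists k : int, y = g k.
Proof.
move=> [TPy indec]; have [k [e [f [ef0 yE]]]] := chain_span TPy.
case: e f ef0 yE => [|e] [|f] // _ yE.
- case: f yE => [|f] yE; first by exists (k + 1); rewrite yE /combo mul0r add0r mul1r.
  case: indec; exists (g (k + 1)), (combo k 0 f.+1); split; first exact: chainTP.
    by apply: combo_TP; lia.
  by rewrite yE /combo; ring.
- case: e yE => [|e] yE; first by exists k; rewrite yE /combo mul0r addr0 mul1r.
  case: indec; exists (g k), (combo k e.+1 0); split; first exact: chainTP.
    by apply: combo_TP; lia.
  by rewrite yE /combo; ring.
case: indec; exists (g k), (combo k e f.+1); split; first exact: chainTP.
  by apply: combo_TP; lia.
by rewrite yE /combo; ring.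
Qed.

(** * Uniqueness of decompositions into chain elements *)

Definition combo_seq (j : int) (e f : nat) : seq R :=
  nseq e (g j) ++ nseq f (g (j + 1)).

Lemma sum_combo_seq (j : int) (e f : nat) : \sum_(y <- combo_seq j e f) y = combo j e f.
Proof. by rewrite big_cat /= !sum_nseq. Qed.

Lemma mem_combo_seq (j : int) (e f : nat) (y : R) :
  y \in combo_seq j e f -> y = g j \/ y = g (j + 1).
Proof.
by rewrite mem_cat !mem_nseq => /orP [] /andP [_ /eqP]; [left|right].
Qed.

Lemma perm_combo_seq (j : int) (t : seq R) :
  (forall y, y \in t -> y = g j \/ y = g (j + 1)) ->
  exists e f : nat, perm_eq t (combo_seq j e f).
Proof.
elim: t => [_|z t IH zt]; first by exists 0%N, 0%N.
have [|e [f tE]] := IH; first by move=> y yt; apply: zt; rewrite in_cons yt orbT.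
have [->|->] := zt z (mem_head _ _).
  by exists e.+1, f; rewrite /= perm_cons.
exists e, f.+1; rewrite perm_sym /combo_seq /= -(cat1s _ (nseq f _)).
by rewrite perm_catCA /= perm_cons perm_sym.
Qed.

(** [pairing i k] depends on [k] only through [g k]; it is 0 at [k = i] and positive for [k > i]. *)
Lemma chain_inj : injective g.
Proof.
have neq (i k : int) : i < k -> g i <> g k.
  move=> ik gik; have V2 := v_ge2 `|(i + 1)%R|%N.
  have : 0 < pairing i k.
    have [ik2|ki2] := leP (i + 2) k.
      apply: lt_le_trans ((pairing_right (ltW ik)).2 ik2).
      by rewrite mulr_gt0 ?delta_gt0 // ltr0n; lia.
    have -> : k = i + 1 by lia.
    by rewrite pairing_next delta_gt0.
  by rewrite -coord_r_chain -gik coord_r_chain pairingxx ltxx.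
by move=> i k gik; have [/neq|/neq|] := ltgtP i k => // h; case: h.
Qed.

Lemma decomposition_chain (x : R) (t : seq R) (y : R) :
  indecomposable_decomposition D x t -> y \in t -> exists k : int, y = g k.
Proof. by case=> indec _ /indec /indecomposableP. Qed.

Lemma lform_decomposition (A B x : R) (t : seq R) :
  indecomposable_decomposition D x t ->
  lform A B x = \sum_(y <- t) lform A B y.
Proof. by case=> indec ->; apply: lform_sum => y /indec [[]]. Qed.

(* A summand g k with k > j + 1 makes the coordinate along g (j + 1) too large
   unless compensated by one with k < j, and two such summands make the
   coordinate sum too large. *)
Lemma decomposition_mem (j : int) (e f : nat) (t : seq R) :
  (e < v `|j|%N)%N -> (f < v `|(j + 1)%R|%N)%N ->
  ~ (e.+1 = v `|j|%N /\ f.+1 = v `|(j + 1)%R|%N) ->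
  indecomposable_decomposition D (combo j e f) t ->
  forall y, y \in t -> y = g j \/ y = g (j + 1).
Proof.
move=> eV fV efV dec y yt.
have [k yE] := decomposition_chain dec yt.
(* Two such summands have coordinate sums adding up to at least the two weights minus 2, whereas
   [e + f] is smaller because the corner pair is excluded. *)
have outside (i i' : int) : g i \in t -> g i' \in t -> j + 2 <= i -> i' <= j - 1 -> False.
  move=> it i't ij i'j.
  have hpos z : z \in t -> 0 <= hform j z.
    move/(decomposition_chain dec) => [m ->]; rewrite hform_chain.
    exact/(le_trans (ltW delta_gt0))/height_ge.
  have neq : g i != g i'.
    by apply/negP => /eqP /chain_inj; lia.
  have := le_sum_mem2 hpos it i't neq.
  rewrite -(lform_decomposition _ _ dec) -/(hform _ _) hform_combo !hform_chain.
  have := (height_right (j := j) (k := i) ltac:(lia)).2 ij.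
  have := (height_left (j := j) (k := i') ltac:(lia)).2 i'j.
  have : (e + f)%:R * delta < ((v `|j|%N)%:R - 1 + ((v `|(j + 1)%R|%N)%:R - 1)) * delta.
    rewrite ltr_pM2r ?delta_gt0 // addrACA -opprD -natrD -(natrD _ 1 1) -natrB.
      by rewrite ltr_nat; lia.
    by have := v_ge2 `|j|; have := v_ge2 `|(j + 1)%R|; lia.
  by rewrite mulrDl; lra.
have [ki|ik] := leP (j + 2) k.
  (* A summand with negative [coord_r] would lie left of [j], against [outside]. Without one, the
     coordinate of [g k] is at most [f], yet at least the weight at [j + 1]. *)
  exfalso; have [/hasP [z zt] /= |none] := boolP (has (fun z => coord_r j z < 0) t).
    have [i zE] := decomposition_chain dec zt; rewrite zE coord_r_chain => neg.
    apply: (outside k i); rewrite -?yE -?zE //; rewrite leNgt; apply/negP => ij.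
    by have [] := (pairing_right (j := j) (k := i) ltac:(lia)); lra.
  have pos z : z \in t -> 0 <= coord_r j z.
    by move=> zt; rewrite leNgt; move: zt; apply: (hasPn none).
  have := le_sum_mem pos yt; rewrite -(lform_decomposition _ _ dec) -/(coord_r _ _).
  rewrite coord_r_combo yE coord_r_chain => h.
  have := le_trans ((pairing_right (j := j) (k := k) ltac:(lia)).2 ki) h.
  by rewrite ler_pM2r ?delta_gt0 // ler_nat; lia.
have [kj|jk] := leP k (j - 1).
  exfalso; have [/hasP [z zt] /= |none] := boolP (has (fun z => coord_l j z < 0) t).
    have [i zE] := decomposition_chain dec zt; rewrite zE coord_l_chain => neg.
    apply: (outside i k); rewrite -?yE -?zE //; rewrite leNgt; apply/negP => ij.
    by have [] := (pairing_left (j := j) (k := i) ltac:(lia)); lra.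
  have pos z : z \in t -> 0 <= coord_l j z.
    by move=> zt; rewrite leNgt; move: zt; apply: (hasPn none).
  have := le_sum_mem pos yt; rewrite -(lform_decomposition _ _ dec) -/(coord_l _ _).
  rewrite coord_l_combo yE coord_l_chain => h.
  have := le_trans ((pairing_left (j := j) (k := k) ltac:(lia)).2 kj) h.
  by rewrite ler_pM2r ?delta_gt0 // ler_nat; lia.
have : k = j \/ k = j + 1 by lia.
by rewrite yE => -[->|->]; [left|right].
Qed.

(** Once only [g j] and [g (j + 1)] can occur, the two coordinates determine their
    multiplicities. *)
Lemma combo_unique (j : int) (e f : nat) : (0 < e + f)%N ->
  (e < v `|j|%N)%N -> (f < v `|(j + 1)%R|%N)%N ->
  ~ (e.+1 = v `|j|%N /\ f.+1 = v `|(j + 1)%R|%N) ->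
  uniquely_decomposable D (combo j e f).
Proof.
move=> ef0 eV fV efV; split; first exact: combo_TP.
exists (combo_seq j e f); split.
  split; last by rewrite sum_combo_seq.
  by move=> y /mem_combo_seq [->|->]; exact: indecomposable_chain.
move=> t dec; have mem_t := decomposition_mem eV fV efV dec.
have [e1 [f1 tE]] := perm_combo_seq mem_t.
have xE : combo j e f = combo j e1 f1.
  by case: dec => _ ->; rewrite (perm_big _ tE) sum_combo_seq.
have inj (m n : nat) : m%:R * delta = n%:R * delta -> m = n.
  by move/(mulIf (lt0r_neq0 delta_gt0))/eqP; rewrite eqr_nat => /eqP.
have -> : e = e1 by apply: inj; rewrite -(coord_l_combo j e f) xE coord_l_combo.
by have -> : f = f1 by apply: inj; rewrite -(coord_r_combo j e f) xE coord_r_combo.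
Qed.

Lemma uniquely_decomposable_mem (x y : R) (t1 t2 : seq R) :
  uniquely_decomposable D x -> indecomposable_decomposition D x t1 ->
  indecomposable_decomposition D x t2 -> y \in t1 -> y \in t2.
Proof.
by case=> _ [t [_ ut]] /ut /perm_mem -> /ut /perm_mem ->.
Qed.

Lemma uniquely_decomposable_combo (j : int) (e f : nat) :
  uniquely_decomposable D (combo j e f) ->
  [/\ (e < v `|j|%N)%N, (f < v `|(j + 1)%R|%N)%N &
    ~ (e.+1 = v `|j|%N /\ f.+1 = v `|(j + 1)%R|%N)].
Proof.
move=> ud.
have dec1 : indecomposable_decomposition D (combo j e f) (combo_seq j e f).
  split; last by rewrite sum_combo_seq.
  by move=> y /mem_combo_seq [->|->]; exact: indecomposable_chain.
(* Each violated condition will produce a decomposition containing [g (j - 1)] or [g (j + 2)],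
   absent from [combo_seq j e f]. *)
have prev_or_next2 (k : int) (t : seq R) : k = j - 1 \/ k = j + 2 ->
    (forall y, y \in t -> exists i : int, y = g i) ->
    combo j e f = \sum_(y <- g k :: t) y -> False.
  move=> kE tg xE; have dec2 : indecomposable_decomposition D (combo j e f) (g k :: t).
    split => // y; rewrite in_cons => /orP [/eqP ->|/tg [i ->]]; exact: indecomposable_chain.
  have := uniquely_decomposable_mem ud dec2 dec1 (mem_head _ _).
  by move/mem_combo_seq => [] /chain_inj; lia.
have e_prev : g (j - 1) + g (j + 1) = (v `|j|%N)%:R * g j by exact: chain_rec.
have e_next : g j + g (j + 2) = (v `|(j + 1)%R|%N)%:R * g (j + 1).
  by have := chain_rec (j + 1); rewrite addrK; have -> : j + 1 + 1 = j + 2 by lia.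
split.
- rewrite ltnNge; apply/negP => Ve.
  apply: (prev_or_next2 (j - 1) (g (j + 1) :: combo_seq j (e - v `|j|%N) f)).
  + by left.
  + by move=> y; rewrite in_cons => /orP [/eqP ->|/mem_combo_seq [] ->]; eexists.
  by rewrite !big_cons sum_combo_seq addrA e_prev /combo natrB //; ring.
- rewrite ltnNge; apply/negP => Vf.
  apply: (prev_or_next2 (j + 2) (g j :: combo_seq j e (f - v `|(j + 1)%R|%N))).
  + by right.
  + by move=> y; rewrite in_cons => /orP [/eqP ->|/mem_combo_seq [] ->]; eexists.
  by rewrite !big_cons sum_combo_seq addrA (addrC (g (j + 2))) e_next /combo natrB //; ring.
(* Adding the recurrences at [j] and [j + 1] and cancelling [g j + g (j + 1)] shows that the corner
   combination equals [g (j - 1) + g (j + 2)]. *)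
move=> [eV fV]; apply: (prev_or_next2 (j - 1) [:: g (j + 2)]).
- by left.
- by move=> y; rewrite inE => /eqP ->; eexists.
rewrite !big_cons big_nil addr0 /combo.
have : (g (j - 1) + g (j + 1)) + (g j + g (j + 2)) = e.+1%:R * g j + f.+1%:R * g (j + 1).
  by rewrite e_prev e_next eV fV.
by rewrite -!natr1 => h; apply: (addIr (g j + g (j + 1))); rewrite [RHS]addrACA [g j + _]addrC;
  lra.
Qed.

(** Conjugation turns a combination at [j] into one at [- (j + 1)] with [e] and [f] exchanged, so up
    to conjugation the position is nonnegative. *)
Lemma uniquely_decomposable_chain (x : R) :
  uniquely_decomposable D x <->
  exists y : R, (x = y \/ x = conj D y) /\
  exists j e f : nat, [/\ (0 < e)%N, (e < v j)%N, (f < v j.+1)%N,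
    ~ (e.+1 = v j /\ f.+1 = v j.+1) & y = e%:R * b j + f%:R * b j.+1].
Proof.
have absS (j : nat) : `|(j%:Z + 1)%R|%N = j.+1 by lia.
have comboE (j e f : nat) : combo j e f = e%:R * b j + f%:R * b j.+1.
  by rewrite /combo; have -> : j%:Z + 1 = j.+1 by lia.
have conj_combo (j : int) (e f : nat) : conj D (combo j e f) = combo (- (j + 1)) f e.
  have [_] := ring_of_integers_lin e f (chainO j) (chainO (j + 1)).
  rewrite /combo => ->; rewrite -!chain_opp addrC.
  by have -> : - (j + 1) + 1 = - j by lia.
split=> [ud|[y [xy [j [e [f [e0 eV fV efV yE]]]]]]].
  have [[Ox x0 x'0] _] := ud.
  have [x'x|xx'] := leP (conj D x) x.
    have [j [e [f [e0 xE]]]] := span_ge ud.1 x'x.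
    have := ud; rewrite xE => /uniquely_decomposable_combo []; rewrite absS => eV fV efV.
    by exists (combo j e f); split; [left|exists j, e, f; rewrite comboE].
  have [|j [e [f [e0 xE]]]] := span_ge (totally_positive_conj ud.1).
    by rewrite conjK ?ltW.
  exists (combo j e f); split; first by right; rewrite -xE conjK.
  exists j, e, f; rewrite comboE.
  have := ud; rewrite -[x]conjK // xE conj_combo => /uniquely_decomposable_combo [].
  have -> : - (j%:Z + 1) + 1 = - j%:Z by lia.
  rewrite !abszN absS /= => fV eV efV; split => // -[e1 f1]; exact: efV.
have ud : uniquely_decomposable D (combo j e f).
  by apply: combo_unique; rewrite ?absS //; lia.
case: xy => ->; rewrite yE -comboE // conj_combo; apply: combo_unique.
- lia.
- by rewrite abszN absS.
- have -> : - (j%:Z + 1) + 1 = - j%:Z by lia.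
  by rewrite abszN.
have -> : - (j%:Z + 1) + 1 = - j%:Z by lia.
by rewrite !abszN absS /= => -[f1 e1]; exact: efV.
Qed.

End Chain.

(** * The chain of the alpha_(i,r) *)

Section ContinuedFraction.
Variable u : nat -> nat.
Hypotheses (u_gt0 : forall i, (0 < u i)%N) (u_sigma : is_cfrac u (sigma R D)).
Local Notation a' := (fun n => conj D (alpha R D u n)).

Lemma conj_alpha n : conj D (alpha R D u n) = (cf_p u n)%:R - (cf_q u n)%:R * w.
Proof. exact: (conj_qint (cf_p u n) (cf_q u n)). Qed.

Lemma alphaO n : O (alpha R D u n).
Proof. by apply/ring_of_integersP; exists (cf_p u n), (cf_q u n). Qed.

Lemma conj_alpha_rec n : a' n.+2 = (u n.+1)%:R * a' n.+1 + a' n.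
Proof.
have [_] := ring_of_integers_lin (u n.+1) 1 (alphaO n.+1) (alphaO n).
by rewrite !mul1r -alpha_rec.
Qed.

Lemma u0_floor : exists k : nat,
  u 0%N = (2 * k + omega_trace)%N /\ sigma R D = w + k%:R.
Proof.
have /andP [u0x xu0] := is_cfrac_floor u_gt0 u_sigma; move: u0x xu0.
rewrite /sigma conj_omega opprB; set k := Num.floor _ => u0x xu0.
(* With t the trace, omega - t lies in [k, k + 1), so sigma = omega + k lies in [2k + t, 2k + t +
   1), and [u 0] is its floor. *)
have := floor_itv (w - omega_trace%:R); rewrite -/k rmorphD /= => /andP [kw wk].
have h1 : (2 * k + omega_trace%:Z < (u 0%N)%:Z + 1)%R.
  by rewrite -(ltr_int R) !rmorphD /= intrM -!pmulrn; lra.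
have h2 : ((u 0%N)%:Z < 2 * k + omega_trace%:Z + 1)%R.
  by rewrite -(ltr_int R) !rmorphD /= intrM -!pmulrn; lra.
have u0 := u_gt0 0; have t1 : (omega_trace <= 1)%N by rewrite /omega_trace; case: eqP.
exists `|k|%N; split; first by lia.
by rewrite natr_abszE //; lia.
Qed.

Lemma uphalf_u0 : (uphalf (u 0%N))%:R - w = (u 0%N)%:R - sigma R D.
Proof.
have [k [-> ->]] := u0_floor.
have -> : uphalf (2 * k + omega_trace) = (k + omega_trace)%N.
  have : (omega_trace <= 1)%N by rewrite /omega_trace; case: eqP.
  lia.
by rewrite !natrD; ring.
Qed.

Lemma conj_alpha1 : conj D (alpha R D u 1) = (u 0%N)%:R - sigma R D.
Proof. by rewrite conj_alpha /cf_p /cf_q /= mul1r uphalf_u0. Qed.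

(** The first two conjugates are 1 and [u 0] - sigma, which is minus the inverse of the complete
    quotient of the shifted expansion; [cf_alternate] applies to that expansion. *)
Lemma conj_alpha_sign n : 0 < (-1) ^+ n * a' n.
Proof.
have u0x := is_cfrac_gt u_gt0 u_sigma.
apply: (@cf_alternate _ (fun n => u n.+1) (sigma R D - (u 0%N)%:R)^-1 a') => //.
- exact: is_cfrac_tail.
- by move=> m; rewrite conj_alpha_rec.
- by rewrite alpha0 (conj_int 1).
rewrite alpha0 (conj_int 1) conj_alpha1; field.
by rewrite subr_eq0 gt_eqF.
Qed.

Lemma alpha_seqO j : O ((alpha_seq u R D) j).
Proof.
have [+ _] := ring_of_integers_lin 1 (index_of u j).2 (alphaO (index_of u j).1) (alphaO (index_of u j).1.+1).
by rewrite mul1r.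
Qed.

Lemma conj_alphar n r : conj D (alphar R D u n r) = a' n + r%:R * a' n.+1.
Proof.
have [_] := ring_of_integers_lin 1 r (alphaO n) (alphaO n.+1).
by rewrite !mul1r.
Qed.

Lemma conj_alpha_even n : ~~ odd n -> 0 < a' n.
Proof. by move=> en; have := conj_alpha_sign n; rewrite -signr_odd (negPf en) mul1r. Qed.

Lemma conj_alpha_odd n : ~~ odd n -> a' n.+1 < 0.
Proof.
by move=> en; have := conj_alpha_sign n.+1; rewrite -signr_odd /= en mulN1r oppr_gt0.
Qed.

Lemma conj_alpha_seq_decr j : conj D ((alpha_seq u R D) j.+1) < conj D ((alpha_seq u R D) j).
Proof.
have [en _] := index_ofP u_gt0 j; rewrite (alpha_seqS u_gt0) /alpha_seq !conj_alphar -natr1.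
by have := conj_alpha_odd en; lra.
Qed.

(** In row [n] the conjugates decrease with [r] towards the conjugate of [alpha n.+2], which is
    positive as [n] is even. *)
Lemma conj_alpha_seq_gt0 j : 0 < conj D ((alpha_seq u R D) j).
Proof.
have [en ru] := index_ofP u_gt0 j; rewrite conj_alphar.
have := conj_alpha_even (n := (index_of u j).1.+2); rewrite /= negbK => /(_ en).
rewrite conj_alpha_rec; have := conj_alpha_odd en.
move=> y1_lt0 h; apply: (lt_le_trans h).
rewrite addrC lerD2l; apply: ler_wnM2r; first exact: ltW.
by rewrite ler_nat; exact: ltnW.
Qed.

(** With [u 0] = 2k + t, where t is the trace of omega, the half rounded up is k + t, so the trace
    of [alpha_seq 1] is 2 (k + t + 1) - t = [u 0] + 2. *)
Lemma alpha_seq1_trace : (alpha_seq u R D) 1 + conj D ((alpha_seq u R D) 1) = (weight u 0)%:R.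
Proof.
rewrite [in conj _ _](alpha_seqS u_gt0) conj_alphar /= alpha0 (conj_int 1) conj_alpha1 mul1r.
rewrite (alpha_seq1 u_gt0) conj_omega.
rewrite /weight /= natrD -natr1.
have := uphalf_u0; have [k [u0E ->]] := u0_floor.
have -> : (u 0%N)%:R = 2 * k%:R + omega_trace%:R :> R by rewrite u0E natrD natrM.
by lra.
Qed.

Lemma uniquely_decomposable_alpha_seq (x : R) :
  uniquely_decomposable D x <->
  exists y : R, (x = y \/ x = conj D y) /\
  exists j e f : nat, [/\ (0 < e)%N, (e < weight u j)%N, (f < weight u j.+1)%N,
    ~ (e.+1 = weight u j /\ f.+1 = weight u j.+1) &
    y = e%:R * (alpha_seq u R D) j + f%:R * (alpha_seq u R D) j.+1].
Proof.
apply: uniquely_decomposable_chain.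
- exact: alpha_seq0.
- by exists (uphalf (u 0%N)).+1; exact: (alpha_seq1 u_gt0).
- exact: alpha_seqO.
- exact: weight_ge2.
- exact: alpha_seq_rec.
- exact: alpha_seq1_trace.
- exact: conj_alpha_seq_gt0.
- exact: conj_alpha_seq_decr.
Qed.

End ContinuedFraction.

End QuadraticField.

(* Here n stands for i + 1: alphar R D u n r is alpha_(i,r), and
   u n, u n.+1, u n.+2 are u_(i+1), u_(i+2), u_(i+3). *)
Theorem theorem4p1 (R : realType) (D : nat) (hD : (2 <= D)%N)
    (hsf : squarefree D) (s : nat) (u : nat -> nat)
    (hu : is_periodic_cfrac s u (sigma R D)) (x : R) :
  uniquely_decomposable D x <->
  exists y : R, (x = y \/ x = conj D y) /\
  exists n : nat, ~~ odd n /\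
    ((exists r : nat, (r <= u n.+1 - 1)%N /\ y = alphar R D u n r)
  \/ (exists e : nat, (2 <= e <= u n + 1)%N /\ y = e%:R * alphar R D u n 0)
  \/ ((2 <= u n.+1)%N /\
      exists f : nat, (1 <= f <= u n.+2)%N /\
        y = alphar R D u n (u n.+1 - 1) + f%:R * alphar R D u n.+2 0)
  \/ ((2 <= u n.+1)%N /\
      exists e : nat, (1 <= e <= u n)%N /\
        y = e%:R * alphar R D u n 0 + alphar R D u n 1)
  \/ (u n.+1 = 1%N /\
      exists e f : nat,
        [/\ (1 <= e <= u n + 1)%N, (1 <= f <= u n.+2 + 1)%N,
            (e, f) <> ((u n + 1)%N, (u n.+2 + 1)%N)
          & y = e%:R * alphar R D u n 0 + f%:R * alphar R D u n.+2 0])).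
Proof.
have [_ u_gt0 _ u_sigma] := hu.
rewrite (uniquely_decomposable_alpha_seq hD hsf u_gt0 u_sigma).
split=> -[y [xy hy]]; exists y; split=> //.
  have [n [r [e [f [n_even [ru h]]]]]] := (alpha_seq_comboP u_gt0 D y).1 hy.
  cbv zeta in h; have [e0 eV fV efV yE] := h.
  have wrap := alphar_wrap u R D n.
  exists n; split=> //; have un := u_gt0 n.
  (* A multiple of one element: [e = 1] is (a), while [e >= 2] needs a weight above 2, hence [r = 0]
     and (b). *)
  case: (posnP f) => [f0|f_gt0].
    rewrite f0 mul0r addr0 in yE.
    have [e1|e2] := leqP e 1.
      by left; exists r; split; [lia|rewrite yE (_ : e = 1%N) ?mul1r //; lia].
    right; left; move: eV yE; case: eqP => [-> eV ->|_]; last by lia.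
    by exists e; split=> //; lia.
  (* A row of length 1 has only [r = 0], and its successor already opens the next row: case (e). *)
  have [u2|u1] := leqP 2 (u n.+1); last first.
    do 4 right; split; first lia.
    have r0 : r = 0%N by lia.
    have uE : u n.+1 = 1%N by lia.
    move: eV fV efV yE; rewrite r0 uE /= -uE wrap => eV fV efV yE.
    exists e, f; split=> //; try lia.
    by case=> eE fE; apply: efV; lia.
  case: (ltnP r.+1 (u n.+1)) fV efV yE => [ru1 fV efV yE|ur fV efV yE].
    (* The right weight is 2, so [f = 1]. For nonzero [r] the left weight would be 2 too and (1, 1)
       the excluded corner; thus [r = 0], case (d). *)
    have r0 : r = 0%N by move: eV efV; case: eqP => //; lia.
    do 3 right; left; split=> //; move: eV efV yE; rewrite r0 /= => eV efV yE.
    exists e; rewrite yE (_ : f = 1%N) ?mul1r; last lia.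
    by split=> //; lia.
  (* The last element of a row of length at least 2 has weight 2, so [e = 1]: case (c). *)
  do 2 right; left; split=> //; move: eV efV; case: eqP => [|_ eV efV]; first lia.
  exists f; rewrite yE (_ : e = 1%N) ?mul1r; last lia.
  have -> : r.+1 = u n.+1 by lia.
  rewrite wrap; have -> : r = (u n.+1 - 1)%N by lia.
  by split=> //; lia.
apply/(alpha_seq_comboP u_gt0 D).
have [n [n_even cases]] := hy.
have wrap := alphar_wrap u R D n.
have un := u_gt0 n; have un1 := u_gt0 n.+1; have un2 := u_gt0 n.+2.
case: cases => [[r [ru ->]]|[[e [eu ->]]|[[u2 [f [fu ->]]]|[[u2 [e [eu ->]]]|[u1 [e [f [eu fu ef ->]]]]]]]].
- exists n, r, 1%N, 0%N; split=> //; split; first lia.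
  split; [lia|by case: ifP => _; lia|by case: ifP => _; lia| |].
    by case: (r.+1 < _)%N; lia.
  by rewrite mul1r mul0r addr0.
- exists n, 0%N, e, 0%N; split=> //; split; first lia.
  split=> /=; [lia|lia|by case: ifP => _; lia| |].
    by case: (1 < _)%N; lia.
  by rewrite mul0r addr0.
- exists n, (u n.+1 - 1)%N, 1%N, f; split=> //; split; first lia.
  have -> : ((u n.+1 - 1).+1 < u n.+1)%N = false by lia.
  have -> : (u n.+1 - 1 == 0)%N = false by lia.
  have -> : (u n.+1 - 1).+1 = u n.+1 by lia.
  by split; [| |lia|lia|rewrite mul1r wrap].
- exists n, 0%N, e, 1%N; split=> //; split; first lia.
  by rewrite u2; split=> //=; [lia|lia|lia|rewrite mul1r].
exists n, 0%N, e, f; split=> //; split; first lia.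
rewrite u1 /= -u1 wrap; split=> //; try lia.
by case=> eE fE; apply: ef; congr (_, _); lia.
Qed.
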